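(* For every non-negative integer $N$, \[\sum_{\pi\in\mathcal{D}_{\le N}} (-1)^{\mathcal{E}(\pi)} q^{\mathcal{O}(\pi)} = (-q;q^2)_{\lceil N/2\rceil},\qquad \sum_{\pi\in\mathcal{P}_{\le N}} (-1)^{\mathcal{E}(\pi)} q^{\mathcal{O}(\pi)} = \frac{1}{(q^2;q^2)_{\lfloor N/2\rfloor}}.\]
   Context: A partition $\pi=(\lambda_1,\lambda_2,\dots)$ is a finite non-increasing sequence of positive integers; the empty sequence is the unique partition of $0$. $\mathcal{P}_{\le N}$ is the set of partitions with all parts $\le N$, $\mathcal{D}_{\le N}$ the set of partitions into distinct parts all $\le N$. $\mathcal{O}(\pi)=\lambda_1+\lambda_3+\cdots$, $\mathcal{E}(\pi)=\lambda_2+\lambda_4+\cdots$. $(a;q)_l=\prod_{i=0}^{l-1}(1-aq^i)$. Identities of formal power series in $q$. *)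

(* Defs.v *)
From HB Require Import structures.
From mathcomp Require Import all_boot all_algebra.
From mathcomp Require Import boolp classical_sets cardinality fsbigop.

Set Implicit Arguments.
Unset Strict Implicit.
Unset Printing Implicit Defensive.

Import GRing.Theory.
Local Open Scope ring_scope.

(* [coefs f n] is the coefficient of degree [n].  This is a record rather than
   an alias of [nat -> R] because [nat -> R] already carries the pointwise
   product. *)
Record fps (R : Type) := Fps { coefs : nat -> R }.
Arguments Fps {R} _.

Lemma fpsP (R : Type) (f g : fps R) : coefs f =1 coefs g -> f = g.
Proof. by case: f g => [f] [g] /= /funext ->. Qed.

HB.instance Definition _ (R : Type) := gen_eqMixin (fps R).
HB.instance Definition _ (R : Type) := gen_choiceMixin (fps R).

Section FpsZmodule.
Variable R : zmodType.
Implicit Types f g : fps R.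

Definition fps_zero : fps R := Fps (fun=> 0).
Definition fps_opp f := Fps (fun n => - coefs f n).
Definition fps_add f g := Fps (fun n => coefs f n + coefs g n).

Lemma fps_addA : associative fps_add.
Proof. by move=> f g h; apply: fpsP => n /=; rewrite addrA. Qed.

Lemma fps_addC : commutative fps_add.
Proof. by move=> f g; apply: fpsP => n /=; rewrite addrC. Qed.

Lemma fps_add0 : left_id fps_zero fps_add.
Proof. by move=> f; apply: fpsP => n /=; rewrite add0r. Qed.

Lemma fps_addN : left_inverse fps_zero fps_opp fps_add.
Proof. by move=> f; apply: fpsP => n /=; rewrite addNr. Qed.

HB.instance Definition _ := GRing.isZmodule.Build (fps R)
  fps_addA fps_addC fps_add0 fps_addN.

End FpsZmodule.

Section FpsRing.
Variable R : comNzRingType.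
Implicit Types f g h : fps R.

Definition fps_one : fps R := Fps (fun n => (n == 0)%:R).
Definition fps_mul f g :=
  Fps (fun n => \sum_(i < n.+1) coefs f i * coefs g (n - i)).

Definition fps_trunc n f : {poly R} := \poly_(i < n.+1) coefs f i.

Lemma coef_fps_trunc n f i : (i <= n)%N -> (fps_trunc n f)`_i = coefs f i.
Proof. by move=> le_in; rewrite coef_poly ltnS le_in. Qed.

Lemma coef_fps_mul n f g (p q : {poly R}) :
    (forall i, (i <= n)%N -> p`_i = coefs f i) ->
    (forall i, (i <= n)%N -> q`_i = coefs g i) ->
  forall i, (i <= n)%N -> (p * q)`_i = coefs (fps_mul f g) i.
Proof.
move=> pf qg i le_in; rewrite coefM /=; apply: eq_bigr => j _.
rewrite pf ?qg //; first exact: leq_trans (leq_subr _ _) le_in.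
by apply: leq_trans le_in; rewrite -ltnS.
Qed.

Lemma fps_mulC : commutative fps_mul.
Proof.
move=> f g; apply: fpsP => n.
rewrite -(coef_fps_mul (@coef_fps_trunc n f) (@coef_fps_trunc n g)) //.
by rewrite -(coef_fps_mul (@coef_fps_trunc n g) (@coef_fps_trunc n f)) // mulrC.
Qed.

Lemma fps_mulA : associative fps_mul.
Proof.
move=> f g h; apply: fpsP => n.
have Tf := @coef_fps_trunc n f; have Tg := @coef_fps_trunc n g.
have Th := @coef_fps_trunc n h.
rewrite -(coef_fps_mul Tf (coef_fps_mul Tg Th)) //.
by rewrite -(coef_fps_mul (coef_fps_mul Tf Tg) Th) // mulrA.
Qed.

Lemma fps_mul1 : left_id fps_one fps_mul.
Proof.
move=> f; apply: fpsP => n /=; rewrite big_ord_recl /= mul1r subn0 big1 ?addr0 //.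
by move=> i _; rewrite mul0r.
Qed.

Lemma fps_mulDl : left_distributive fps_mul (@fps_add R).
Proof.
move=> f g h; apply: fpsP => n /=; rewrite -big_split /=.
by apply: eq_bigr => i _; rewrite mulrDl.
Qed.

Lemma fps_one_neq0 : fps_one != 0.
Proof.
apply/eqP => /(congr1 (fun f => coefs f 0)) /= /eqP.
by rewrite oner_eq0.
Qed.

HB.instance Definition _ := GRing.Zmodule_isComNzRing.Build (fps R)
  fps_mulA fps_mulC fps_mul1 fps_mulDl fps_one_neq0.

Definition fpsX : fps R := Fps (fun n => (n == 1)%:R).

Lemma coefs0 n : coefs (0 : fps R) n = 0.
Proof. by []. Qed.

Lemma coefs1 n : coefs (1 : fps R) n = (n == 0)%:R.
Proof. by []. Qed.

Lemma coefsD f g n : coefs (f + g) n = coefs f n + coefs g n.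
Proof. by []. Qed.

Lemma coefsN f n : coefs (- f) n = - coefs f n.
Proof. by []. Qed.

Lemma coefsM f g n :
  coefs (f * g) n = \sum_(i < n.+1) coefs f i * coefs g (n - i).
Proof. by []. Qed.

Lemma coefsXM f n : coefs (fpsX * f) n = if n is m.+1 then coefs f m else 0.
Proof.
rewrite coefsM; case: n => [|n].
  by rewrite big_ord_recl big_ord0 /= mul0r addr0.
rewrite !big_ord_recl /= mul0r add0r mul1r subSS subn0 big1 ?addr0 //.
by move=> i _; rewrite mul0r.
Qed.

Lemma coefsXn k n : coefs (fpsX ^+ k) n = (n == k)%:R.
Proof.
elim: k n => [|k IHk] [|n]; rewrite ?expr0 ?coefs1 //.
  by rewrite exprS coefsXM.
by rewrite exprS coefsXM IHk eqSS.
Qed.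

Lemma coefs_signM b f n : coefs ((-1) ^+ b * f) n = (-1) ^+ b * coefs f n.
Proof.
elim: b => [|b IHb]; first by rewrite !expr0 !mul1r.
by rewrite !exprS -!mulrA !mulN1r coefsN IHb.
Qed.

End FpsRing.

Arguments fpsX {R}.

Section FpsUnitRing.
Variable R : comUnitRingType.
Implicit Types f g h : fps R.

Definition fps_unit : pred (fps R) := fun f => coefs f 0 \is a GRing.unit.

(* The first [n] coefficients of the inverse of [f], from the recurrence
   g_n = f_0^-1 * ([n = 0] - \sum_(i < n) g_i f_(n-i)). *)
Fixpoint fps_inv_seq f n : seq R :=
  if n is m.+1 then
    let s := fps_inv_seq f m in
    rcons s ((coefs f 0)^-1 *
             ((m == 0)%:R - \sum_(i < m) s`_i * coefs f (m - i)))
  else [::].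

Definition fps_inv f : fps R :=
  if fps_unit f then Fps (fun n => (fps_inv_seq f n.+1)`_n) else f.

Lemma size_fps_inv_seq f n : size (fps_inv_seq f n) = n.
Proof. by elim: n => //= n IHn; rewrite size_rcons IHn. Qed.

Lemma nth_fps_inv_seq f n i :
  (i < n)%N -> (fps_inv_seq f n)`_i = (fps_inv_seq f i.+1)`_i.
Proof.
elim: n => // n IHn; rewrite ltnS leq_eqVlt => /predU1P[-> //|lt_in].
by rewrite [LHS]nth_rcons size_fps_inv_seq lt_in IHn.
Qed.

Lemma fps_mulVr : {in fps_unit, left_inverse 1 fps_inv *%R}.
Proof.
move=> f uf; rewrite /fps_inv (uf : fps_unit f); apply: fpsP => n.
rewrite coefsM coefs1 big_ord_recr /= subnn.
rewrite nth_rcons size_fps_inv_seq ltnn eqxx mulrAC mulVr // mul1r.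
under eq_bigr => i _ do rewrite -[rcons _ _]/(fps_inv_seq f i.+1)
  -(nth_fps_inv_seq f (ltn_ord i)).
by rewrite addrC subrK.
Qed.

Lemma fps_unitPl f g : g * f = 1 -> fps_unit f.
Proof.
move=> /(congr1 (fun h => coefs h 0)).
rewrite coefsM big_ord_recl big_ord0 addr0 /= => gf1.
by apply/unitrPr; exists (coefs g 0); rewrite mulrC.
Qed.

Lemma fps_inv_out : {in [predC fps_unit], fps_inv =1 id}.
Proof. by move=> f /negbTE uf; rewrite /fps_inv (uf : fps_unit f = false). Qed.

HB.instance Definition _ := GRing.ComNzRing_hasMulInverse.Build (fps R)
  fps_mulVr fps_unitPl fps_inv_out.

Lemma fps_unitE f : (f \is a GRing.unit) = (coefs f 0 \is a GRing.unit).
Proof. by []. Qed.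

End FpsUnitRing.

(* A family is summable when every coefficient involves finitely many of its
   members.  The value of [fps_sum] is meaningful for summable families only:
   a finitely supported sum with infinite support is 0 by convention. *)
Definition fps_summable (R : zmodType) (T : choiceType) (A : set T)
    (F : T -> fps R) : Prop :=
  forall n, finite_set [set x | A x /\ coefs (F x) n <> 0].

Definition fps_sum (R : zmodType) (T : choiceType) (A : set T)
    (F : T -> fps R) : fps R :=
  Fps (fun n => \sum_(x \in A) coefs (F x) n).

Definition qpochhammer (R : pzRingType) (a q : R) (l : nat) : R :=
  \prod_(i < l) (1 - a * q ^+ i).

Definition is_partition (p : seq nat) : bool :=
  sorted geq p && all (leq 1) p.

Definition partitions_le (N : nat) : set (seq nat) :=
  [set p | is_partition p /\ all (fun x => x <= N)%N p]%classic.

Definition distinct_partitions_le (N : nat) : set (seq nat) :=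
  [set p | partitions_le N p /\ uniq p]%classic.

(* Positions are counted from 0, so the parts lambda_1, lambda_3, ... are
   those at even positions. *)
Definition odd_indexed_sum (p : seq nat) : nat :=
  (\sum_(i < size p | ~~ odd i) nth 0 p i)%N.

Definition even_indexed_sum (p : seq nat) : nat :=
  (\sum_(i < size p | odd i) nth 0 p i)%N.

Definition partition_weight (p : seq nat) : fps int :=
  (-1) ^+ even_indexed_sum p * fpsX ^+ odd_indexed_sum p.

Lemma partition_size_le (p : seq nat) :
  is_partition p -> (size p <= (odd_indexed_sum p).*2)%N.
Proof.
case/andP=> _ /all_nthP p_gt0.
suff : (uphalf (size p) <= odd_indexed_sum p)%N.
  by rewrite leq_uphalf_double.
have -> : uphalf (size p) = (\sum_(i < size p | ~~ odd i) 1)%N.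
  elim: (size p) => [|n IHn]; first by rewrite big_ord0.
  rewrite big_mkcond big_ord_recr -big_mkcond /= -IHn !uphalf_half addnC.
  by rewrite /=; case: (odd n).
by apply: leq_sum => i _; exact: p_gt0.
Qed.

Lemma partitions_le_summable (N : nat) :
  fps_summable (partitions_le N) partition_weight.
Proof.
move=> n.
pose f (b : {bseq n.*2 of 'I_N.+1}) : seq nat := map val b.
apply: (@sub_finite_set _ _ (f @` setT)%classic); last first.
  exact/finite_image/finite_finset.
move=> p [[part_p p_le]]; rewrite /partition_weight coefs_signM coefsXn.
case: eqVneq => [n_eq _|]; last by rewrite mulr0.
have le_size : (size (map (@inord N) p) <= n.*2)%N.
  by rewrite size_map n_eq partition_size_le.
exists (Bseq le_size) => //; rewrite /f /= -map_comp map_id_in // => x xp /=.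
by rewrite inordK // ltnS; exact: (allP p_le).
Qed.

Lemma distinct_partitions_le_summable (N : nat) :
  fps_summable (distinct_partitions_le N) partition_weight.
Proof.
move=> n; apply: sub_finite_set (@partitions_le_summable N n).
by move=> p /= [[]].
Qed.

Lemma qpochhammer_unit (l : nat) :
  qpochhammer (fpsX ^+ 2 : fps int) (fpsX ^+ 2) l \is a GRing.unit.
Proof.
apply: rpred_prod => i _.
by rewrite fps_unitE -exprS -exprM coefsD coefsN coefsXn coefs1 mulnS subr0 unitr1.
Qed.

(* Main.v *)
(** Deleting the largest part of a partition exchanges the odd- and the
    even-indexed parts.  Pairing each weight (-1)^E q^O with its swap (-1)^O q^E
    therefore gives, for distinct parts, the linear system
      D_(N+1) = D_N + q^(N+1) D'_N,        D'_(N+1) = D'_N + (-1)^(N+1) D_N,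
    and for arbitrary parts
      P_(N+1) = P_N + q^(N+1) P'_(N+1),    P'_(N+1) = P'_N + (-1)^(N+1) P_(N+1).
    The swapped series equals the original one for N even and vanishes for N odd,
    so each system collapses to a one-term recurrence. *)
Require Import Defs.
From mathcomp Require Import all_boot all_algebra.
From mathcomp Require Import boolp classical_sets cardinality fsbigop.
From mathcomp Require Import ring.

Set Implicit Arguments.
Unset Strict Implicit.
Unset Printing Implicit Defensive.

Import GRing.Theory.
Local Open Scope ring_scope.
Local Open Scope classical_set_scope.

(** * Sums of families of power series *)

Lemma fps_summable_sub (R : zmodType) (T : choiceType) (A B : set T)
    (F : T -> fps R) :
  A `<=` B -> fps_summable B F -> fps_summable A F.
Proof. by move=> AB sB n; apply: sub_finite_set (sB n) => x [/AB]. Qed.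

Lemma eq_fps_sum (R : zmodType) (T : choiceType) (A : set T)
    (F G : T -> fps R) :
  F =1 G -> fps_sum A F = fps_sum A G.
Proof. by move=> /funext ->. Qed.

Lemma fps_sum_set1 (R : zmodType) (T : choiceType) (x : T) (F : T -> fps R) :
  fps_sum [set x] F = F x.
Proof. by apply: fpsP => n /=; rewrite fsbig_set1. Qed.

Lemma fps_sumU (R : zmodType) (T : choiceType) (A B : set T)
    (F : T -> fps R) :
    fps_summable A F -> fps_summable B F -> A `&` B `<=` set0 ->
  fps_sum (A `|` B) F = fps_sum A F + fps_sum B F.
Proof.
move=> sA sB AB0; apply: fpsP => n /=.
(* [fsbigU0] asks for finite index sets, and only the supports are finite, so each sum is first
   restricted to its support. *)
rewrite fsbig_supp [X in _ = X + _]fsbig_supp [X in _ = _ + X]fsbig_supp.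
rewrite setIUl fsbigU0 //; [exact: sA | exact: sB |].
by move=> x [[Ax _] [Bx _]]; exact: AB0.
Qed.

Lemma fps_sum_image (R : zmodType) (T U : choiceType) (h : T -> U)
    (A : set T) (F : U -> fps R) :
  injective h -> fps_sum (h @` A) F = fps_sum A (F \o h).
Proof.
move=> injh; apply: fpsP => n /=; rewrite fsbig_image // => x y _ _.
exact: injh.
Qed.

(** Multiplying by [fpsX] only shifts coefficients, so each coefficient of the left side is either
    zero or a single earlier coefficient sum. *)
Lemma fps_sumXnM (R : comNzRingType) (T : choiceType) (A : set T)
    (F : T -> fps R) k :
  fps_sum A (fun x => fpsX ^+ k * F x) = fpsX ^+ k * fps_sum A F.
Proof.
elim: k => [|k IHk].
  by rewrite expr0 mul1r; apply: eq_fps_sum => x; rewrite mul1r.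
rewrite exprS -mulrA -IHk.
under eq_fps_sum => x do rewrite -mulrA.
apply: fpsP => n; rewrite coefsXM.
rewrite -[LHS]/(\sum_(x \in A) coefs (fpsX * (fpsX ^+ k * F x)) n).
under eq_fsbigr => x _ do rewrite coefsXM.
by case: n => //; rewrite fsbig1.
Qed.

(** Coefficientwise this is a scalar factor pulled out of a finitely supported sum. *)
Lemma fps_sum_signM (R : idomainType) (T : choiceType) (A : set T)
    (F : T -> fps R) k :
  fps_sum A (fun x => (-1) ^+ k * F x) = (-1) ^+ k * fps_sum A F.
Proof.
apply: fpsP => n; rewrite coefs_signM [RHS]mulr_fsumr.
rewrite -[LHS]/(\sum_(x \in A) coefs ((-1) ^+ k * F x) n).
by under eq_fsbigr => x _ do rewrite coefs_signM.
Qed.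

(** * Deleting the largest part *)

Definition swapped_weight (p : seq nat) : fps int :=
  (-1) ^+ odd_indexed_sum p * fpsX ^+ even_indexed_sum p.

Lemma odd_indexed_sum_cons k p :
  odd_indexed_sum (k :: p) = (k + even_indexed_sum p)%N.
Proof.
rewrite /odd_indexed_sum /even_indexed_sum big_mkcond big_ord_recl /=.
by congr addn; rewrite [RHS]big_mkcond; apply: eq_bigr => i _ /=; rewrite negbK.
Qed.

Lemma even_indexed_sum_cons k p :
  even_indexed_sum (k :: p) = odd_indexed_sum p.
Proof.
rewrite /odd_indexed_sum /even_indexed_sum big_mkcond big_ord_recl /= add0n.
by rewrite [RHS]big_mkcond; apply: eq_bigr => i _ /=.
Qed.

Lemma partition_weight_cons k p :
  partition_weight (k :: p) = fpsX ^+ k * swapped_weight p.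
Proof.
rewrite /partition_weight /swapped_weight odd_indexed_sum_cons.
by rewrite even_indexed_sum_cons exprD mulrCA.
Qed.

Lemma swapped_weight_cons k p :
  swapped_weight (k :: p) = (-1) ^+ k * partition_weight p.
Proof.
rewrite /partition_weight /swapped_weight odd_indexed_sum_cons.
by rewrite even_indexed_sum_cons exprD mulrA.
Qed.

Lemma partition_weight_nil : partition_weight [::] = 1.
Proof.
by rewrite /partition_weight /odd_indexed_sum /even_indexed_sum !big_ord0 mul1r.
Qed.

Lemma swapped_weight_nil : swapped_weight [::] = 1.
Proof.
by rewrite /swapped_weight /odd_indexed_sum /even_indexed_sum !big_ord0 mul1r.
Qed.

Lemma partitions_le_cons N k p :
  partitions_le N (k :: p) <-> (0 < k <= N)%N /\ partitions_le k p.
Proof.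
rewrite /partitions_le /is_partition /= (path_sortedE (rev_trans leq_trans)).
split=> [[/andP[/andP[lepk sp] /andP[k0 p0]] /andP[kN _]]|].
  by rewrite k0 kN sp p0.
move=> [/andP[k0 kN] [/andP[sp p0] pk]]; rewrite k0 kN sp p0 /= !andbT.
by split=> //; apply: sub_all pk => x /leq_trans; apply.
Qed.

Lemma partitions_le_leq M N : (M <= N)%N -> partitions_le M `<=` partitions_le N.
Proof.
move=> MN [|k p] // /partitions_le_cons[/andP[k0 kM] kp].
by apply/partitions_le_cons; rewrite k0 (leq_trans kM).
Qed.

Lemma partitions_le0 : partitions_le 0 = [set [::]].
Proof.
apply/seteqP; split=> [[|k p] // /partitions_le_cons[]|p ->//].
by case: k.
Qed.

Lemma distinct_partitions_le0 : distinct_partitions_le 0 = [set [::]].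
Proof.
rewrite /distinct_partitions_le partitions_le0.
by apply/seteqP; split=> [p []|p ->].
Qed.

(** The split is on whether the largest part is [N.+1]. That part may be repeated, so the set itself
    reappears under [cons], which makes the recurrences for arbitrary parts implicit. *)
Lemma partitions_leS N :
  partitions_le N.+1 = partitions_le N `|` cons N.+1 @` partitions_le N.+1.
Proof.
apply/seteqP; split=> [[|k p]|p [|[s sN <-]]].
- by left.
- case/partitions_le_cons=> /andP[k0]; rewrite leq_eqVlt => /predU1P[-> pk|kN pk].
    by right; exists p.
  by left; apply/partitions_le_cons; rewrite k0.
- exact: partitions_le_leq.
- by apply/partitions_le_cons; rewrite leqnn.
Qed.

(** Distinctness forbids a second [N.+1], so the tail has parts at most [N] and the recurrences are
    explicit. *)
Lemma distinct_partitions_leS N :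
  distinct_partitions_le N.+1 =
  distinct_partitions_le N `|` cons N.+1 @` distinct_partitions_le N.
Proof.
apply/seteqP; split=> [p [pN up]|p [[pN up]|[s [sN us] <-]]].
- move: pN up; rewrite partitions_leS => -[pN|[s sN <-]] /=; first by left.
  case/andP=> Ns us; right; exists s => //; split=> //; case: sN => sP sN.
  split=> //; apply/allP => x xs; rewrite -ltnS ltn_neqAle (allP sN) // andbT.
  by apply: contraNneq Ns => <-.
- by split=> //; exact: partitions_le_leq pN.
- split.
    by apply/partitions_le_cons; rewrite leqnn; split=> //; exact: partitions_le_leq sN.
  rewrite /= us andbT; case: sN => _ /allP sN.
  by apply/negP => /sN; rewrite ltnn.
Qed.

Lemma partitions_le_consI N (A : set (seq nat)) :
  partitions_le N `&` cons N.+1 @` A `<=` set0.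
Proof.
by move=> p [+ [s _ eqp]]; rewrite -eqp => /partitions_le_cons[]; rewrite ltnn andbF.
Qed.

(** Prepending [N.+1] turns the swapped weight into the ordinary one, up to sign and a degree shift
    by [N.+1]; [behead] undoes this, so finiteness carries over. *)
Lemma partitions_le_swapped_summable N :
  fps_summable (partitions_le N) swapped_weight.
Proof.
move=> n.
apply: sub_finite_set
  (finite_image behead (@partitions_le_summable N.+1 (N.+1 + n)%N)).
move=> p [pN pn0]; exists (N.+1 :: p) => //; split.
  by apply/partitions_le_cons; rewrite leqnn; split=> //; exact: partitions_le_leq pN.
rewrite partition_weight_cons; move: pn0; rewrite /swapped_weight.
by rewrite mulrCA -exprD !coefs_signM !coefsXn eqn_add2l.
Qed.

(** Serves both families: [C] is [A] for arbitrary parts and [B] for distinct parts. *)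
Lemma fps_sum_consU N (A B C : set (seq nat)) (F : seq nat -> fps int) :
    A = B `|` cons N.+1 @` C -> A `<=` partitions_le N.+1 ->
    B `<=` partitions_le N ->
    fps_summable (partitions_le N.+1) F ->
  fps_sum A F = fps_sum B F + fps_sum C (F \o cons N.+1).
Proof.
move=> ->; rewrite subUset => -[BN CN] BN' sF; rewrite fps_sumU.
- by rewrite fps_sum_image // => p q [].
- exact: fps_summable_sub sF.
- exact: fps_summable_sub sF.
- by apply: subset_trans (@partitions_le_consI N C); exact: setSI.
Qed.

Lemma fps_sum_partition_weight N (A B C : set (seq nat)) :
    A = B `|` cons N.+1 @` C -> A `<=` partitions_le N.+1 ->
    B `<=` partitions_le N ->
  fps_sum A partition_weight =
  fps_sum B partition_weight + fpsX ^+ N.+1 * fps_sum C swapped_weight.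
Proof.
move=> eA AN BN; rewrite (fps_sum_consU eA AN BN (@partitions_le_summable _)).
by rewrite -fps_sumXnM; congr (_ + _); apply: eq_fps_sum => p;
  exact: partition_weight_cons.
Qed.

Lemma fps_sum_swapped_weight N (A B C : set (seq nat)) :
    A = B `|` cons N.+1 @` C -> A `<=` partitions_le N.+1 ->
    B `<=` partitions_le N ->
  fps_sum A swapped_weight =
  fps_sum B swapped_weight + (-1) ^+ N.+1 * fps_sum C partition_weight.
Proof.
move=> eA AN BN.
rewrite (fps_sum_consU eA AN BN (@partitions_le_swapped_summable _)).
by rewrite -fps_sum_signM; congr (_ + _); apply: eq_fps_sum => p;
  exact: swapped_weight_cons.
Qed.

(** * Solving the recurrences *)

Lemma qpochhammer0 (R : pzRingType) (a q : R) : qpochhammer a q 0 = 1.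
Proof. exact: big_ord0. Qed.

Lemma qpochhammerS (R : pzRingType) (a q : R) l :
  qpochhammer a q l.+1 = qpochhammer a q l * (1 - a * q ^+ l).
Proof. exact: big_ord_recr. Qed.

(** The two sums are found by one induction, since each recurrence involves the other sum. *)
Lemma distinct_partitions_le_sums N :
  let D := qpochhammer (- fpsX : fps int) (fpsX ^+ 2) (uphalf N) in
  fps_sum (distinct_partitions_le N) partition_weight = D /\
  fps_sum (distinct_partitions_le N) swapped_weight = if odd N then 0 else D.
Proof.
elim: N => [|N [IHw IHs]] /=.
  rewrite distinct_partitions_le0 !fps_sum_set1 qpochhammer0.
  by rewrite partition_weight_nil swapped_weight_nil.
have DN M : distinct_partitions_le M `<=` partitions_le M by move=> p [].
have eD := distinct_partitions_leS N.
rewrite (fps_sum_partition_weight eD) // (fps_sum_swapped_weight eD) //.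
rewrite IHw IHs -signr_odd /= uphalf_half.
(* For [N] odd the swapped sum vanishes and the product is unchanged. For [N] even the swapped sums
   cancel and the factor [1 + fpsX ^+ N.+1] appears. *)
case: (boolP (odd N)) => oN /=.
  by rewrite mulr0 addr0 add0r expr0 mul1r.
rewrite add0n expr1 mulN1r subrr qpochhammerS; split=> //.
rewrite -exprM mulNr -exprS opprK mulrDr mulr1 mulrC mul2n.
by rewrite even_halfK.
Qed.

Lemma fps_unit1DXn (R : comUnitRingType) n :
  1 + fpsX ^+ n.+1 \is a @GRing.unit (fps R).
Proof. by rewrite fps_unitE coefsD coefsXn addr0 unitr1. Qed.

Lemma partitions_le_sums N :
  let P := fps_sum (partitions_le N) partition_weight in
  P * qpochhammer (fpsX ^+ 2 : fps int) (fpsX ^+ 2) N./2 = 1 /\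
  fps_sum (partitions_le N) swapped_weight = if odd N then 0 else P.
Proof.
elim: N => [|N [IHw IHs]] /=.
  rewrite partitions_le0 !fps_sum_set1 qpochhammer0.
  by rewrite partition_weight_nil swapped_weight_nil mulr1.
have eP := partitions_leS N.
have /= Ew := fps_sum_partition_weight eP (@subset_refl _ _) (@subset_refl _ _).
have /= Es := fps_sum_swapped_weight eP (@subset_refl _ _) (@subset_refl _ _).
move: IHw IHs Ew Es; rewrite -signr_odd /= uphalf_half.
set P := fps_sum (partitions_le N) _; set P' := fps_sum (partitions_le N) _.
set Q := fps_sum (partitions_le N.+1) _; set Q' := fps_sum (partitions_le N.+1) _.
case: (boolP (odd N)) => oN /= IHw -> Ew Es.
  (* For [N] odd, [P'] is zero and the sign is [+1]. Substituting [Q' = Q] gives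
     [P = (1 - fpsX ^+ N.+1) * Q], whose factor is the next one of the product. *)
  have eQ : Q' = Q by rewrite Es expr0 mul1r add0r.
  split=> //; rewrite qpochhammerS -[RHS]IHw.
  have -> : P = Q - fpsX ^+ N.+1 * Q by rewrite {1}Ew eQ addrK.
  rewrite -exprM -exprD -mulnS mul2n doubleS.
  have -> : N./2.*2.+2 = N.+1 by rewrite -[in RHS](odd_double_half N) oN.
  by ring.
(* For [N] even, [P' = P] gives [Q' = P - Q]. Hence [Q] and [P] agree after multiplication by the
   unit [1 + fpsX ^+ N.+1], which is cancelled. *)
have eQ : Q = P.
  apply/(mulrI (fps_unit1DXn _ N)); rewrite Es expr1 in Ew.
  by rewrite mulrDl mul1r {1}Ew; ring.
by split; [rewrite eQ | rewrite Es eQ expr1 mulN1r subrr].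
Qed.

Theorem theorem4p4 (N : nat) :
  fps_sum (distinct_partitions_le N) partition_weight
    = qpochhammer (- fpsX : fps int) (fpsX ^+ 2) (uphalf N)
  /\
  fps_sum (partitions_le N) partition_weight
    = 1 / qpochhammer (fpsX ^+ 2 : fps int) (fpsX ^+ 2) (N./2).
Proof.
split; first by case: (distinct_partitions_le_sums N).
by case: (partitions_le_sums N) => <- _; rewrite mulrK // qpochhammer_unit.
Qed.
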